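(* Let $d\geq 2$ and $k\geq 1$ be integers. Let ${\bf c}=(c_n)_{n\in\mathbb{N}}$ be any oscillating sequence of order $m=d+k-1$, and let $f:\mathbb{R}^d\to\mathbb{R}^d$ be any simple polynomial skew product of degree $k$. Then ${\bf c}$ and $f$ are linearly disjoint; that is, for every continuous function $\phi:\mathbb{T}^d\to\mathbb{C}$ and every ${\bf x}\in\mathbb{R}^d$, $$\lim_{N\to\infty}\frac1N\sum_{n=1}^N c_n\,\phi(\pi(f^n{\bf x}))=0,$$ where $\pi:\mathbb{R}^d\to\mathbb{T}^d=\mathbb{R}^d/\mathbb{Z}^d$ is the natural projection.
   Context: $\mathbb{N}=\{1,2,\dots\}$, and $f^n$ denotes the $n$-fold composition of $f$. Standing assumptions on sequences: every sequence ${\bf c}=(c_n)_{n\in\mathbb{N}}$ of complex numbers considered satisfies $\lim_{N\to\infty}\frac1N\sum_{n=1}^N c_n=0$, and there are constants $C>0$ and $\lambda>1$ such that $\frac1N\sum_{n=1}^N|c_n|^\lambda\leq C$ for all $N\geq 1$. Oscillating sequence of order $m$ ($m\geq 2$): for every polynomial $P$ with real coefficients and degree at most $m$, $\lim_{N\to\infty}\frac1N\sum_{n=1}^N c_n e^{2\pi i P(n)}=0$. Simple polynomial skew product of degree $k$: a map $f:\mathbb{R}^d\to\mathbb{R}^d$ sending ${\bf x}=(x_1,\dots,x_d)$ to the point whose first coordinate is $x_1+a$, whose second coordinate is $x_2+h_2(x_1)$, and whose $i$-th coordinate for $3\leq i\leq d$ is $x_i+\sum_{j=2}^{i-1}b_{ij}x_j+h_i(x_1)$.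 Here $a$ is a real constant, the $b_{ij}$ ($3\leq i\leq d$, $2\leq j\leq i-1$) are integers, and the $h_i$ ($2\leq i\leq d$) are real polynomials in $x_1$ of degree at most $k$. *)

(* Defs.v *)
From HB Require Import structures.
From mathcomp Require Import all_boot all_order all_algebra.
From mathcomp Require Import all_classical all_reals all_analysis.
From mathcomp Require Import generic_quotient complex.

Set Implicit Arguments.
Unset Strict Implicit.
Unset Printing Implicit Defensive.

Import Order.TTheory GRing.Theory Num.Theory.
Import numFieldNormedType.Exports.
Import ComplexField.Normc.

Local Open Scope classical_set_scope.
Local Open Scope ring_scope.
Local Open Scope complex_scope.
Local Open Scope quotient_scope.

(* Congruence modulo Z^d on R^d; [torus R d] is the topological quotient. *)
Definition torus_rel (R : realType) (d : nat) (x y : 'rV[R]_d) : bool :=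
  [forall j, x ord0 j - y ord0 j \is a Num.int].

Lemma torus_rel_refl (R : realType) (d : nat) : reflexive (@torus_rel R d).
Proof. by move=> x; apply/forallP => j; rewrite subrr rpred0. Qed.

Lemma torus_rel_sym (R : realType) (d : nat) : symmetric (@torus_rel R d).
Proof. by move=> x y; apply: eq_forallb => j; rewrite -opprB rpredN. Qed.

Lemma torus_rel_trans (R : realType) (d : nat) : transitive (@torus_rel R d).
Proof.
move=> y x z /forallP xy /forallP yz; apply/forallP => j.
by rewrite -(subrKA (y ord0 j)) rpredD.
Qed.

Canonical torus_equiv (R : realType) (d : nat) : equiv_rel 'rV[R]_d :=
  EquivRel (@torus_rel R d) (@torus_rel_refl R d) (@torus_rel_sym R d)
    (@torus_rel_trans R d).

Definition torus (R : realType) (d : nat) : topologicalType :=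
  quotient_topology {eq_quot (torus_equiv R d)}.

Definition torus_proj (R : realType) (d : nat) (x : 'rV[R]_d) : torus R d :=
  \pi_{eq_quot (torus_equiv R d)} x.

(* e(t) = exp(2 pi i t) *)
Definition expi (R : realType) (t : R) : R[i] :=
  cos (2 * trigo.pi * t) +i* sin (2 * trigo.pi * t).

(* Sequences are indexed by n >= 1; the value of [u] at 0 is never used. The
   topology on the complex numbers is that of [R[i]^o]. *)
Definition mean_to_zero (R : realType) (u : nat -> R[i]) : Prop :=
  (fun N : nat => N%:R^-1 * \sum_(1 <= n < N.+1) u n : R[i]^o) @ \oo
    --> (0 : R[i]^o).

Definition admissible_seq (R : realType) (c : nat -> R[i]) : Prop :=
  mean_to_zero c /\
  exists C lambda : R, [/\ 0 < C, 1 < lambda &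
    forall N : nat, (1 <= N)%N ->
      N%:R^-1 * \sum_(1 <= n < N.+1) normc (c n) `^ lambda <= C].

Definition oscillating (R : realType) (m : nat) (c : nat -> R[i]) : Prop :=
  forall P : {poly R}, (size P <= m.+1)%N ->
    mean_to_zero (fun n => c n * expi P.[n%:R]).

(* Coordinates are numbered from 0. Only the entries b i j with 1 <= j < i and
   the polynomials h i with 1 <= i occur. *)
Definition simple_skew_product (R : realType) (d : nat) (hd : (1 < d)%N)
    (k : nat) (f : 'rV[R]_d -> 'rV[R]_d) : Prop :=
  let i0 := Ordinal (ltnW hd) in
  let i1 := Ordinal hd in
  exists (a : R) (b : 'I_d -> 'I_d -> int) (h : 'I_d -> {poly R}),
    (forall i : 'I_d, (1 <= i)%N -> (size (h i) <= k.+1)%N) /\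
    forall x : 'rV[R]_d,
      [/\ f x ord0 i0 = x ord0 i0 + a,
          f x ord0 i1 = x ord0 i1 + (h i1).[x ord0 i0] &
          forall i : 'I_d, (2 <= i)%N ->
            f x ord0 i = x ord0 i
              + \sum_(j < d | (1 <= j < i)%N) (b i j)%:~R * x ord0 j
              + (h i).[x ord0 i0]].

Definition linearly_disjoint (R : realType) (d : nat) (c : nat -> R[i])
    (f : 'rV[R]_d -> 'rV[R]_d) : Prop :=
  forall phi : torus R d -> R[i]^o, continuous phi ->
  forall x : 'rV[R]_d,
    mean_to_zero (fun n => c n * phi (torus_proj (iter n f x))).

(* Main.v *)
Require Import Defs.
From mathcomp Require Import all_boot all_order all_algebra.
From mathcomp Require Import all_classical all_reals all_analysis.
From mathcomp Require Import complex.
From mathcomp Require Import zify ring lra.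

Set Implicit Arguments.
Unset Strict Implicit.
Unset Printing Implicit Defensive.

Import Order.TTheory GRing.Theory Num.Theory.
Import numFieldNormedType.Exports.
Import ComplexField.Normc.

Local Open Scope classical_set_scope.
Local Open Scope ring_scope.
Local Open Scope complex_scope.

(* Every coordinate of [f^n x] is a polynomial in [n] of degree at most
   [d + k - 1], because each coordinate is an iterated sum of polynomials in the
   previous ones. Hence the oscillation hypothesis handles [phi] a trigonometric
   polynomial, and since the means of [|c_n|] are bounded it remains to
   approximate [phi] uniformly by such functions. This is done as in Bernstein's
   proof of the Weierstrass theorem: the de la Vallee-Poussin kernel
   [(1 + cos (2 pi t))^M], sampled at the points [j / (M + 2)] and normalized, is
   an exact partition of unity whose mean of [1 - cos (2 pi (x - j / (M + 2)))] is
   exactly [1 / (M + 1)], while compactness of the torus bounds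
   [|phi x - phi y|] by [e + K * sum_i (1 - cos (2 pi (x_i - y_i)))]. *)

(** * Complex exponentials, means of sequences, and exponential sums with polynomial phases *)

Section ExponentialMeans.
Variable R : realType.
Implicit Types (t x : R) (u v c : nat -> R[i]) (P Q : {poly R}).

Lemma expiD t x : expi (t + x) = expi t * expi x.
Proof.
by rewrite /expi mulrDr cosD sinD; simpc; rewrite [X in _ +i* X]addrC.
Qed.

Lemma expi0 : expi 0 = 1 :> R[i].
Proof. by rewrite /expi mulr0 cos0 sin0. Qed.

Lemma expi1 : expi 1 = 1 :> R[i].
Proof. by rewrite /expi mulr1 mulr_natl cos2pi sin2pi. Qed.

Lemma expiN t : expi (- t) = (expi t)^-1.
Proof.
have e1 : expi t * expi (- t) = 1 by rewrite -expiD subrr expi0.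
by rewrite (mulr1_eq e1).
Qed.

Lemma expiMn t n : expi (t *+ n) = expi t ^+ n.
Proof.
elim: n => [|n IH]; first by rewrite mulr0n expi0 expr0.
by rewrite mulrSr expiD IH exprSr.
Qed.

Lemma expi_int x : x \is a Num.int -> expi x = 1.
Proof.
have nat1 n : expi n%:R = 1 :> R[i] by rewrite expiMn expi1 expr1n.
case/intrP => -[] n ->; first exact: nat1.
by rewrite NegzE mulrNz expiN nat1 invr1.
Qed.

(** Since [cos (2 pi |x|) = 1 - 2 sin^2 (pi |x|)], the value 1 forces [sin (pi |x|) = 0], impossible
    when [pi |x|] lies strictly between 0 and pi. *)
Lemma expi_eq1 x : `|x| < 1 -> expi x = 1 -> x = 0.
Proof.
move=> x1 [cos1 _]; apply/eqP; rewrite -normr_eq0; apply/negPn/negP => x0.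
have {x0} x0 : 0 < `|x| by rewrite lt_neqAle eq_sym x0 normr_ge0.
have cos_abs : cos (2 * trigo.pi * `|x|) = 1.
  by case: (ger0P x) => // _; rewrite mulrN cosN.
have sin_gt0 : 0 < sin (trigo.pi * `|x|).
  by apply: sin_gt0_pi; rewrite mulr_gt0 ?pi_gt0 //= gtr_pMr ?pi_gt0.
have := cos_mulr2n (trigo.pi * `|x|).
have -> : (trigo.pi * `|x|) *+ 2 = 2 * trigo.pi * `|x| by ring.
rewrite cos_abs cos2sin2.
have : 0 < sin (trigo.pi * `|x|) ^+ 2 by rewrite exprn_gt0.
lra.
Qed.

Lemma cos_expi t : (cos (2 * trigo.pi * t))%:C = (expi t + expi (- t)) / 2.
Proof.
rewrite /expi mulrN cosN sinN.
set a := cos _; set b := sin _.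
have -> : (a +i* b) + (a -i* b) = (2 * a)%:C :> R[i].
  by apply/eqP; rewrite eq_complex /= subrr eqxx andbT mulr_natl mulr2n.
by rewrite rmorphM rmorph_nat mulrAC mulfV ?mul1r // pnatr_eq0.
Qed.

Lemma normc_sum I (r : seq I) (F : I -> R[i]) :
  normc (\sum_(i <- r) F i) <= \sum_(i <- r) normc (F i).
Proof.
elim/big_rec2: _ => [|i y z _ yz]; first by rewrite normc0.
by apply: le_trans (le_normcD _ _) _; rewrite lerD2l.
Qed.

Lemma normc_ge0 (z : R[i]) : 0 <= normc z.
Proof. by case: z => a b; exact: sqrtr_ge0. Qed.

Lemma normc_real x : normc x%:C = `|x|.
Proof. by rewrite /= expr0n /= addr0 sqrtr_sqr. Qed.

(** The norm on [R[i]^o] takes values in [R[i]], but a positive element there is real, so real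
    tolerances suffice. *)
Lemma cvg_complexP (u : nat -> R[i]) (l : R[i]) :
  (u : nat -> R[i]^o) @ \oo --> (l : R[i]^o) <->
  forall e : R, 0 < e -> \forall n \near \oo, normc (l - u n) < e.
Proof.
split=> [/cvgrPdist_lt cu e e0|cu].
  have := cu e%:C; rewrite ltcR => /(_ e0); apply: filterS => n.
  by rewrite -[`|_|]/((normc (l - u n))%:C) ltcR.
apply/cvgrPdist_lt => e e0; have e_real : e = (complex.Re e)%:C.
  by rewrite RRe_real // gtr0_real.
move: e0; rewrite e_real ltcR => /cu; apply: filterS => n.
by rewrite -[`|_|]/((normc (l - u n))%:C) ltcR.
Qed.

Lemma mean_to_zeroP u : mean_to_zero u <-> forall e : R, 0 < e ->
  \forall N \near \oo, normc (N%:R^-1 * \sum_(1 <= n < N.+1) u n) < e.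
Proof.
rewrite /mean_to_zero cvg_complexP.
by split=> H e /H; apply: filterS => n; rewrite sub0r normcN.
Qed.

Lemma mean_to_zeroD u v : mean_to_zero u -> mean_to_zero v ->
  mean_to_zero (fun n => u n + v n).
Proof.
move=> /mean_to_zeroP cu /mean_to_zeroP cv; apply/mean_to_zeroP => e e0.
have e2 : 0 < e / 2 by rewrite divr_gt0.
near=> N; rewrite big_split mulrDr (splitr e).
apply: le_lt_trans (le_normcD _ _) _.
by apply: ltrD; near: N; [exact: cu|exact: cv].
Unshelve. all: by end_near. Qed.

Lemma mean_to_zeroZ (z : R[i]) u : mean_to_zero u ->
  mean_to_zero (fun n => z * u n).
Proof.
move=> /mean_to_zeroP cu; apply/mean_to_zeroP => e e0.
have z0 : 0 < 1 + normc z by rewrite ltr_pwDl ?normc_ge0.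
near=> N; rewrite -mulr_sumr mulrCA normcM.
apply: (@le_lt_trans _ _ ((1 + normc z) *
    normc (N%:R^-1 * \sum_(1 <= n < N.+1) u n))).
  by rewrite ler_wpM2r ?normc_ge0 // lerDr.
by rewrite -ltr_pdivlMl //; near: N; apply: cu; rewrite mulr_gt0 ?invr_gt0.
Unshelve. all: by end_near. Qed.

Lemma eq_mean_to_zero u v : u =1 v -> mean_to_zero u -> mean_to_zero v.
Proof. by move=> /funext ->. Qed.

(* [|z| <= 1 + |z| ^ lambda] turns the moment bound into a bound on the means of
   [|c n|]. *)
Lemma admissible_seq_mean_norm c : admissible_seq c ->
  exists2 B : R, 0 < B & forall N, (1 <= N)%N ->
    N%:R^-1 * \sum_(1 <= n < N.+1) normc (c n) <= B.
Proof.
move=> [_ [C [lambda [C0 lambda1 momC]]]].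
exists (1 + C) => [|N N1]; first by rewrite addr_gt0.
have N0 : N%:R != 0 :> R by rewrite pnatr_eq0 -lt0n.
have -> : 1 + C = N%:R^-1 * \sum_(1 <= n < N.+1) (1 : R) + C.
  by rewrite sumr_const_nat subSS subn0 mulVf.
apply: le_trans (lerD (lexx _) (momC N N1)).
rewrite -mulrDr ler_wpM2l ?invr_ge0 ?ler0n // -big_split /=.
apply: ler_sum => n _; have [c1|c1] := leP (normc (c n)) 1.
  by rewrite ler_wpDr // powR_ge0.
by rewrite ler_wpDl // -[leLHS]powRr1 ?normc_ge0 // ler_powR // ltW.
Qed.

(** If [B] bounds the means of [|c n|], a uniform error [e / 2 / B] changes the mean by at most
    [e / 2]; the other half of [e] is left for the mean of [c n * u n]. *)
Lemma mean_to_zero_approx c F : admissible_seq c ->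
  (forall e : R, 0 < e -> exists2 u, mean_to_zero (fun n => c n * u n) &
     forall n, normc (F n - u n) <= e) ->
  mean_to_zero (fun n => c n * F n).
Proof.
move=> /admissible_seq_mean_norm [B B0 cB] approx; apply/mean_to_zeroP => e e0.
have e2 : 0 < e / 2 by rewrite divr_gt0.
have [|u /mean_to_zeroP cu Fu] := approx (e / 2 / B); first by rewrite divr_gt0.
near=> N; have N1 : (1 <= N)%N by near: N; exact: nbhs_infty_ge.
have -> : \sum_(1 <= n < N.+1) c n * F n =
    \sum_(1 <= n < N.+1) c n * u n + \sum_(1 <= n < N.+1) c n * (F n - u n).
  by rewrite -big_split /=; apply: eq_bigr => n _; rewrite -mulrDr addrC subrK.
rewrite mulrDr (splitr e); apply: le_lt_trans (le_normcD _ _) _.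
apply: ltr_leD; first by near: N; apply: cu.
have normcN1 : normc (N%:R^-1 : R[i]) = N%:R^-1.
  rewrite normcV; congr (_^-1).
  by rewrite -(rmorph_nat (real_complex R)) normc_real normr_nat.
rewrite normcM normcN1.
apply: le_trans (_ : N%:R^-1 * \sum_(1 <= n < N.+1) normc (c n) * (e / 2 / B)
  <= _).
  rewrite ler_wpM2l ?invr_ge0 ?ler0n //; apply: le_trans (normc_sum _ _) _.
  apply: ler_sum => n _; rewrite normcM ler_wpM2l ?normc_ge0 //; exact: Fu.
rewrite -mulr_suml mulrA -[leRHS](divfK (lt0r_neq0 B0)) mulrC.
by apply: ler_wpM2l (cB N N1); rewrite divr_ge0 ?ltW.
Unshelve. all: by end_near. Qed.

(** The inductive form avoids explicit index sets: closure under products and vanishing of means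
    against [c] both follow by induction. *)
Inductive exp_sum (m : nat) : (nat -> R[i]) -> Prop :=
| exp_sum_term (z : R[i]) P : (size P <= m.+1)%N ->
    exp_sum m (fun n => z * expi P.[n%:R])
| exp_sumD u v : exp_sum m u -> exp_sum m v -> exp_sum m (fun n => u n + v n).

Lemma eq_exp_sum m u v : u =1 v -> exp_sum m u -> exp_sum m v.
Proof. by move=> /funext ->. Qed.

Lemma exp_sum_const m (z : R[i]) : exp_sum m (fun=> z).
Proof.
apply: (@eq_exp_sum m (fun n => z * expi 0.[n%:R])) => [n|].
  by rewrite horner0 expi0 mulr1.
by apply: exp_sum_term; rewrite size_poly0.
Qed.

(** Multiplying exponentials adds their phases, and the degree of a sum of polynomials does not
    exceed [m]. Products and powers of trigonometric factors therefore cost no degree. *)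
Lemma exp_sumM m u v :
  exp_sum m u -> exp_sum m v -> exp_sum m (fun n => u n * v n).
Proof.
move=> mu mv; elim: mu => [z P sP|u1 u2 _ IH1 _ IH2].
  elim: mv => [y Q sQ|v1 v2 _ IH1 _ IH2].
    apply: (@eq_exp_sum m (fun n => (z * y) * expi (P + Q).[n%:R])) => [n|].
      by rewrite hornerD expiD mulrACA.
    apply: exp_sum_term; apply: leq_trans (size_polyD _ _) _.
    by rewrite geq_max sP.
  apply: eq_exp_sum (exp_sumD IH1 IH2) => n /=; by rewrite mulrDr.
apply: eq_exp_sum (exp_sumD IH1 IH2) => n /=; by rewrite mulrDl.
Qed.

Lemma exp_sum_sum m I (r : seq I) (u : I -> nat -> R[i]) :
  (forall i, exp_sum m (u i)) -> exp_sum m (fun n => \sum_(i <- r) u i n).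
Proof.
move=> mu; elim: r => [|i r IH].
  by apply: eq_exp_sum (exp_sum_const m 0) => n; rewrite big_nil.
by apply: eq_exp_sum (exp_sumD (mu i) IH) => n; rewrite big_cons.
Qed.

Lemma exp_sum_prod m I (r : seq I) (u : I -> nat -> R[i]) :
  (forall i, exp_sum m (u i)) -> exp_sum m (fun n => \prod_(i <- r) u i n).
Proof.
move=> mu; elim: r => [|i r IH].
  by apply: eq_exp_sum (exp_sum_const m 1) => n; rewrite big_nil.
by apply: eq_exp_sum (exp_sumM (mu i) IH) => n; rewrite big_cons.
Qed.

Lemma exp_sumX m u q : exp_sum m u -> exp_sum m (fun n => u n ^+ q).
Proof.
move=> mu; elim: q => [|q IH]; first exact: exp_sum_const.
by apply: eq_exp_sum (exp_sumM mu IH) => n; rewrite exprS.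
Qed.

Lemma exp_sum_cos m P : (size P <= m.+1)%N ->
  exp_sum m (fun n => (cos (2 * trigo.pi * P.[n%:R]))%:C).
Proof.
move=> sP; have sNP : (size (- P) <= m.+1)%N by rewrite size_polyN.
apply: eq_exp_sum (exp_sumD (exp_sum_term 2^-1 sP) (exp_sum_term 2^-1 sNP)) => n.
by rewrite cos_expi hornerN -mulrDr mulrC.
Qed.

Lemma oscillating_exp_sum m c u : oscillating m c -> exp_sum m u ->
  mean_to_zero (fun n => c n * u n).
Proof.
move=> osc; elim=> [z P sP|u1 u2 _ IH1 _ IH2].
  apply: eq_mean_to_zero (mean_to_zeroZ z (osc P sP)) => n; exact: mulrCA.
apply: eq_mean_to_zero (mean_to_zeroD IH1 IH2) => n /=; by rewrite mulrDr.
Qed.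

End ExponentialMeans.

(** * Discrete antiderivatives of polynomials, and orbits of skew products *)

Section SkewProductOrbits.
Variable R : realType.
Implicit Types P Q : {poly R}.

(** The leading terms cancel, and the binomial theorem leaves ['C(s.+1, s)] as the next coefficient.
    It is nonzero in [R], so the difference operator can be inverted degree by degree. *)
Lemma size_XaddC_exp_sub s :
  let D := ('X + 1) ^+ s.+1 - 'X^(s.+1) : {poly R} in
  (size D <= s.+1)%N /\ D`_s = s.+1%:R.
Proof.
have coefD i : (('X + 1) ^+ s.+1 : {poly R})`_i = 'C(s.+1, i)%:R.
  rewrite addrC exprDn coef_sum; have [is1|is1] := ltnP i s.+2.
    rewrite (bigD1 (Ordinal is1)) //= big1 ?addr0.
      by rewrite expr1n mul1r coefMn coefXn eqxx.
    move=> j ji; rewrite expr1n mul1r coefMn coefXn.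
    rewrite (_ : (i == j) = false) ?mul0rn //.
    by apply/negbTE; apply: contra ji => /eqP ij; apply/eqP/val_inj.
  rewrite bin_small // big1 // => j _.
  rewrite expr1n mul1r coefMn coefXn (_ : (i == j) = false) ?mul0rn //.
  by apply/negbTE; rewrite neq_ltn (leq_trans (ltn_ord j)) // orbT.
move=> D; split.
  apply/leq_sizeP => j; rewrite coefB coefD coefXn leq_eqVlt.
  case/predU1P => [<-|sj]; first by rewrite eqxx binn subrr.
  by rewrite bin_small // gtn_eqF // subrr.
by rewrite coefB coefD coefXn (ltn_eqF (ltnSn s)) subr0 binSn.
Qed.

Lemma poly_difference s Q : (size Q <= s)%N -> exists2 P : {poly R},
  (size P <= s.+1)%N & forall x, P.[x + 1] - P.[x] = Q.[x].
Proof.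
elim: s Q => [|s IH] Q.
  rewrite leqn0 size_poly_eq0 => /eqP ->; exists 0; first by rewrite size_poly0.
  by move=> x; rewrite !horner0 subrr.
move=> sQ; have [] := size_XaddC_exp_sub s.
set D := _ - _ => sD Ds.
(* With this [a], the coefficient of index [s] in [Q - a *: D] vanishes, which brings its size down
   to [s]. *)
pose a := Q`_s / s.+1%:R.
have [|P sP PQ] := IH (Q - a *: D).
  apply/leq_sizeP => j; rewrite leq_eqVlt coefB coefZ => /predU1P[<-|sj].
    by rewrite Ds divfK ?subrr // pnatr_eq0.
  by rewrite !(leq_sizeP _ _ _ j sj) // mulr0 subrr.
exists (P + a *: 'X^(s.+1)).
  apply: leq_trans (size_polyD _ _) _; rewrite geq_max (leq_trans sP) //=.
  by apply: leq_trans (size_scale_leq _ _) _; rewrite size_polyXn.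
move=> x; have := PQ x; rewrite /D !hornerE => H.
by rewrite opprD addrACA H; ring.
Qed.

(** A discrete antiderivative of [Q], corrected by a constant to match [y 0], has the same
    increments as [y]. Each summation raises the degree by one. *)
Lemma poly_sum_orbit s Q (y : nat -> R) : (size Q <= s)%N ->
  (forall n, y n.+1 = y n + Q.[n%:R]) ->
  exists2 P : {poly R}, (size P <= s.+1)%N & forall n, y n = P.[n%:R].
Proof.
move=> sQ yS; have [P sP PQ] := poly_difference sQ.
exists (P + (y 0 - P.[0])%:P).
  apply: leq_trans (size_polyD _ _) _; rewrite geq_max sP /=.
  by apply: leq_trans (size_polyC_leq1 _) _.
elim=> [|n IH]; first by rewrite hornerD hornerC addrC subrK.
by rewrite yS IH -PQ !hornerD !hornerC -natr1; ring.
Qed.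

(** The first coordinate is affine in [n], so [h i] evaluated on it has degree at most [k]. Each
    later coordinate sums polynomials of degree below [k + i], hence has degree at most [k + i]; the
    largest index [d - 1] gives the bound. *)
Lemma skew_product_orbit_poly d (hd : (1 < d)%N) k (f : 'rV[R]_d -> 'rV[R]_d) x :
  (1 <= k)%N -> simple_skew_product hd k f ->
  exists P : 'I_d -> {poly R}, forall i, (size (P i) <= (d + k - 1).+1)%N /\
    forall n, iter n f x ord0 i = (P i).[n%:R].
Proof.
move=> k1 [a [b [h [sh fE]]]].
pose good s (i : 'I_d) := exists2 P : {poly R}, (size P <= s)%N &
  forall n, iter n f x ord0 i = P.[n%:R].
have good0 : good 2 (Ordinal (ltnW hd)).
  apply: (@poly_sum_orbit 1 a%:P) => [|n]; first exact: size_polyC_leq1.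
  by rewrite iterS hornerC; have [-> _ _] := fE (iter n f x).
have goodh (i : 'I_d) : (1 <= i)%N -> exists2 Q : {poly R}, (size Q <= k.+1)%N &
    forall n, (h i).[iter n f x ord0 (Ordinal (ltnW hd))] = Q.[n%:R].
  move=> i1; have [P sP xP] := good0; exists (h i \Po P).
    have [hP0|hP0] := eqVneq (h i) 0; first by rewrite hP0 comp_poly0 size_poly0.
    apply: leq_trans (size_comp_poly_leq _ _) _.
    rewrite ltnS; apply: (@leq_trans ((size (h i)).-1 * 1)).
      by rewrite leq_mul2l; case: (size P) sP => [|[|[]]]; rewrite ?orbT.
    by rewrite muln1 -ltnS prednK ?sh // lt0n size_poly_eq0.
  by move=> n; rewrite xP horner_comp.
(* The auxiliary [s] turns this into a strong induction on [i], since coordinate [i] involves all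
   [j] with [1 <= j < i]. *)
have goodi s (i : 'I_d) : (i <= s)%N -> (1 <= i)%N -> good (k + i).+1 i.
  elim: s i => [|s IH] i; first by rewrite leqn0 => /eqP ->.
  move=> iS i1; have [Q sQ hQ] := goodh i i1.
  have [i2|i2] := ltnP 1 i; last first.
    have iE : i = Ordinal hd by apply/val_inj/eqP; rewrite eqn_leq i2 i1.
    apply: (@poly_sum_orbit _ Q) => [|n].
      by apply: leq_trans sQ _; rewrite -addn1 leq_add2l.
    rewrite iterS -hQ iE; by have [_ -> _] := fE (iter n f x).
  (* Choice needs a polynomial for every index; outside the range of summation the zero polynomial
     serves as a default. *)
  have [j|Pj PjE] := @choice _ _ (fun (j : 'I_d) P => (1 <= j < i)%N ->
      (size P <= k + i)%N /\ forall n, iter n f x ord0 j = P.[n%:R]).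
    have [/andP[j1 ji]|] := boolP (1 <= j < i)%N; last by exists 0.
    have [|P sP xP] := IH j _ j1; first by rewrite -ltnS (leq_trans ji).
    by exists P => _; split=> //; apply: leq_trans sP _; rewrite -addnS leq_add2l.
  apply: (@poly_sum_orbit _
    (\sum_(j < d | (1 <= j < i)%N) (b i j)%:~R *: Pj j + Q)) => [|n].
    apply: leq_trans (size_polyD _ _) _; rewrite geq_max; apply/andP; split.
      apply: leq_trans (size_sum _ _ _) _; apply/bigmax_leqP => j ji.
      exact: leq_trans (size_scale_leq _ _) (PjE j ji).1.
    by apply: leq_trans sQ _; rewrite -addn1 leq_add2l.
  have [_ _ /(_ i i2)] := fE (iter n f x); rewrite iterS => ->.
  rewrite hornerD horner_sum -addrA -hQ; congr (_ + (_ + _)).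
  by apply: eq_bigr => j ji; rewrite hornerZ (PjE j ji).2.
have good_all (i : 'I_d) : exists P : {poly R},
    (size P <= (d + k - 1).+1)%N /\ forall n, iter n f x ord0 i = P.[n%:R].
  have dk : (d + k - 1).+1 = (d + k)%N by rewrite subn1 prednK // addn_gt0 k1 orbT.
  rewrite dk; have [i0|i1] := posnP i.
    have [P sP xP] := good0; exists P; split.
      by apply: leq_trans sP _; rewrite (leq_trans hd) ?leq_addr.
    by move=> n; rewrite (_ : i = Ordinal (ltnW hd)) //; apply: val_inj.
  have [P sP xP] := goodi i i (leqnn _) i1; exists P; split => //.
  by apply: leq_trans sP _; rewrite -addnS addnC leq_add2r.
by have [P PE] := choice good_all; exists P.
Qed.

End SkewProductOrbits.

(** * The sampled de la Vallee-Poussin kernel as a partition of unity *)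

Section ValleePoussin.
Variable R : realType.
Implicit Types (t x a : R).

(** This equals [2 ^ M * cos (pi t) ^ (2 M)]: a nonnegative trigonometric polynomial of degree [M]
    that peaks at the integers. *)
Definition vp_kernel (M : nat) t : R := (1 + cos (2 * trigo.pi * t)) ^+ M.

Lemma vp_kernel_ge0 M t : 0 <= vp_kernel M t.
Proof. by rewrite exprn_ge0 // -lerBlDl sub0r cos_geN1. Qed.

(** Expand [1 + cos (2 pi t) = e(-t) (1 + e(t))^2 / 2] by the binomial theorem; the frequencies
    [l - M] run from [-M] to [M]. *)
Lemma vp_kernel_expi M t : (vp_kernel M t)%:C =
  2 ^- M * \sum_(l < (M.*2).+1) 'C(M.*2, l)%:R * expi ((l%:R - M%:R) * t).
Proof.
have e0 : expi t != 0.
  apply/eqP => e0; have : expi t * expi (- t) = 1 by rewrite -expiD subrr expi0.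
  by move/eqP; rewrite e0 mul0r eq_sym oner_eq0.
have -> : (vp_kernel M t)%:C = (2^-1 * (expi (- t) * (1 + expi t) ^+ 2)) ^+ M.
  rewrite rmorphXn rmorphD rmorph1 /= cos_expi expiN; congr (_ ^+ _).
  by field; rewrite e0.
rewrite exprMn exprVn exprMn -exprM mulnC -muln2 mulnC; congr (_ * _).
rewrite exprDn mulr_sumr; apply: eq_bigr => l _.
rewrite expr1n mul1r -!expiMn mulrnAr -expiD mulr_natl; congr (expi _ *+ _).
rewrite -[t *+ l]mulr_natl -[- t *+ M]mulr_natl; ring.
Qed.

(** The ratio of this geometric sum is an [L]-th root of unity, different from 1 because
    [0 < |a / L| < 1]. *)
Lemma expi_sum_eq0 L a : a \is a Num.int -> 0 < `|a| < L%:R ->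
  \sum_(j < L) expi (a / L%:R) ^+ j = 0.
Proof.
move=> aZ /andP[a0 aL]; have L0 : 0 < L%:R :> R by apply: lt_trans aL.
have e1 : expi (a / L%:R) - 1 != 0.
  rewrite subr_eq0; apply/eqP => /expi_eq1 H; move: a0.
  rewrite normr_gt0 => /eqP; apply; apply: (mulIf (invr_neq0 (lt0r_neq0 L0))).
  by rewrite mul0r H // normrM normfV (gtr0_norm L0) ltr_pdivrMr // mul1r.
apply: (mulfI e1); rewrite mulr0 -subrX1 -expiMn -[_ *+ L]mulr_natr.
by rewrite divfK ?lt0r_neq0 // expi_int // subrr.
Qed.

(** Nonzero frequencies have absolute value at most [M < L], so equidistant sampling annihilates
    them. Only the constant Fourier coefficient survives, whence no dependence on [x]. *)
Lemma sum_vp_kernel M L x : (M < L)%N ->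
  \sum_(j < L) vp_kernel M (x - j%:R / L%:R) =
  L%:R * 'C(M.*2, M)%:R / 2 ^+ M.
Proof.
move=> ML; apply: complexI; rewrite rmorph_sum /=.
under eq_bigr do rewrite vp_kernel_expi.
rewrite -mulr_sumr exchange_big /=.
have MM : (M < (M.*2).+1)%N by rewrite ltnS -addnn leq_addr.
rewrite (bigD1 (Ordinal MM)) //= [X in _ + X]big1 ?addr0 => [|l lM].
  rewrite -mulr_sumr; under eq_bigr do rewrite subrr mul0r expi0.
  rewrite sumr_const card_ord !rmorphM fmorphV rmorphXn !rmorph_nat.
  by rewrite [LHS]mulrC [_ * L%:R]mulrC.
rewrite -mulr_sumr; set a := l%:R - M%:R : R.
have -> : \sum_(j < L) expi (a * (x - j%:R / L%:R)) =
    expi (a * x) * \sum_(j < L) expi (- a / L%:R) ^+ j.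
  rewrite mulr_sumr; apply: eq_bigr => j _; rewrite -expiMn -expiD.
  by congr expi; rewrite -[_ *+ j]mulr_natr; ring.
have lM' : (nat_of_ord l != M) by apply: contra lM => /eqP lM; apply/eqP/val_inj.
rewrite expi_sum_eq0 ?mulr0 //; first by rewrite rpredN rpredB ?rpred_nat.
rewrite normrN normr_gt0 subr_eq0 eqr_nat lM' /=.
have lMM : (l <= M + M)%N by rewrite addnn -ltnS ltn_ord.
rewrite /a ltr_distlC ltrBlDr -!natrD !ltr_nat.
by rewrite (leq_ltn_trans lMM) ?ltn_add2l // ltn_addl.
Qed.

(** The divisor is the total given by [sum_vp_kernel]. Taking [M.+2] nodes keeps the sampling exact
    for [vp_kernel M.+1] too, as [sum_vp_weight_dist] requires. *)
Definition vp_weight M (j : 'I_M.+2) x : R :=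
  vp_kernel M (x - j%:R / M.+2%:R) / (M.+2%:R * 'C(M.*2, M)%:R / 2 ^+ M).

Lemma vp_total_gt0 M : 0 < M.+2%:R * 'C(M.*2, M)%:R / 2 ^+ M :> R.
Proof.
by rewrite divr_gt0 ?exprn_gt0 // mulr_gt0 // ltr0n bin_gt0 -addnn leq_addr.
Qed.

Lemma vp_weight_ge0 M j x : 0 <= @vp_weight M j x.
Proof. by rewrite divr_ge0 ?vp_kernel_ge0 ?ltW ?vp_total_gt0. Qed.

Lemma sum_vp_weight M x : \sum_(j < M.+2) vp_weight j x = 1.
Proof.
by rewrite -mulr_suml sum_vp_kernel // mulfV // lt0r_neq0 // vp_total_gt0.
Qed.

Lemma central_binS M :
  (M.+1 * 'C((M.+1).*2, M.+1) = (M.*2.+1).*2 * 'C(M.*2, M))%N.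
Proof.
have := mul_bin_diag (M.*2.+2) M; rewrite doubleS /= => <-.
have := mul_bin_down (M.*2.+1) M; rewrite /= subSn -?addnn ?leq_addr // addnK.
nia.
Qed.

(* [K_M (1 - cos) = 2 K_M - K_(M+1)], and both kernels have explicit totals. *)
Lemma sum_vp_weight_dist M x :
  \sum_(j < M.+2)
    vp_weight j x * (1 - cos (2 * trigo.pi * (x - j%:R / M.+2%:R))) =
  M.+1%:R^-1.
Proof.
pose S : R := M.+2%:R * 'C(M.*2, M)%:R / 2 ^+ M.
have S0 : S != 0 by rewrite lt0r_neq0 // vp_total_gt0.
have -> : \sum_(j < M.+2)
    vp_weight j x * (1 - cos (2 * trigo.pi * (x - j%:R / M.+2%:R))) =
    2 - (\sum_(j < M.+2) vp_kernel M.+1 (x - j%:R / M.+2%:R)) / S.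
  transitivity (\sum_(j < M.+2) (2 * vp_weight j x
      - vp_kernel M.+1 (x - j%:R / M.+2%:R) / S)).
    by apply: eq_bigr => j _; rewrite /vp_weight -/S /vp_kernel exprS; ring.
  by rewrite sumrB -mulr_sumr sum_vp_weight mulr1 -mulr_suml.
(* The totals of [vp_kernel M.+1] and [vp_kernel M] have ratio [(2M + 1) / (M + 1)] by
   [central_binS], and 2 minus this ratio is [1 / (M + 1)]. *)
rewrite sum_vp_kernel // /S.
have M1 : M.+1%:R != 0 :> R by rewrite pnatr_eq0.
have M2 : M.+2%:R != 0 :> R by rewrite pnatr_eq0.
have C0 : 'C(M.*2, M)%:R != 0 :> R.
  by rewrite pnatr_eq0 -lt0n bin_gt0 -addnn leq_addr.
have P0 : 2 ^+ M != 0 :> R by rewrite expf_neq0 // pnatr_eq0.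
have -> : 'C((M.+1).*2, M.+1)%:R =
    2 * (2 * M.+1%:R - 1) * 'C(M.*2, M)%:R / M.+1%:R :> R.
  have := congr1 (fun n => n%:R : R) (central_binS M).
  rewrite /= -!muln2 -[(_ * 2).+1]addn1 !(natrM, natrD) => cbS.
  apply: (mulfI M1); rewrite muln2 in cbS *.
  rewrite cbS [RHS]mulrC divfK // -natr1; ring.
rewrite exprS; field.
by rewrite C0 P0 nat1r -natrD !pnatr_eq0.
Qed.

Lemma sum_ffun_prod_vp_weight d M (x : 'rV[R]_d) :
  \sum_(j : {ffun 'I_d -> 'I_M.+2}) \prod_i vp_weight (j i) (x ord0 i) = 1.
Proof.
rewrite -(bigA_distr_bigA (fun i j => @vp_weight M j (x ord0 i))) big1 // => i _.
exact: sum_vp_weight.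
Qed.

Lemma sum_ffun_prod_vp_weight_dist d M (x : 'rV[R]_d) (i0 : 'I_d) :
  \sum_(j : {ffun 'I_d -> 'I_M.+2}) (\prod_i vp_weight (j i) (x ord0 i)) *
    (1 - cos (2 * trigo.pi * (x ord0 i0 - (j i0)%:R / M.+2%:R))) = M.+1%:R^-1.
Proof.
(* Absorbing the cosine term into the factor of index [i0] lets the sum over [j] factor into
   one-dimensional sums. *)
pose g i (j : 'I_M.+2) := vp_weight j (x ord0 i) *
  (if i == i0 then 1 - cos (2 * trigo.pi * (x ord0 i - j%:R / M.+2%:R)) else 1).
transitivity (\sum_(j : {ffun 'I_d -> 'I_M.+2}) \prod_i g i (j i)).
  apply: eq_bigr => j _.
  by rewrite [RHS]big_split /= -[in RHS]big_mkcond big_pred1_eq.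
rewrite -(bigA_distr_bigA g) (bigD1 i0) //= [X in _ * X]big1 ?mulr1 => [|i ii0].
  by rewrite /g; under eq_bigr do rewrite eqxx; exact: sum_vp_weight_dist.
rewrite /g; under eq_bigr do rewrite (negbTE ii0) mulr1.
exact: sum_vp_weight.
Qed.

(** The weights average [F x - F y] over the nodes [y]. The constant [e] averages to itself, and
    each of the [d] cosine terms averages to [1 / (M + 1)]. *)
Lemma vp_approx d M (F : 'rV[R]_d -> R[i]) (e K : R) :
  (forall x y : 'rV[R]_d, normc (F x - F y) <= e + K *
     \sum_i (1 - cos (2 * trigo.pi * (x ord0 i - y ord0 i)))) ->
  forall x : 'rV[R]_d, normc (F x - \sum_(j : {ffun 'I_d -> 'I_M.+2})
      (\prod_i vp_weight (j i) (x ord0 i))%:C *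
      F (\row_i ((j i)%:R / M.+2%:R))) <= e + K * (d%:R / M.+1%:R).
Proof.
move=> FK x; pose w (j : {ffun 'I_d -> 'I_M.+2}) :=
  \prod_i vp_weight (j i) (x ord0 i).
have w0 j : 0 <= w j by apply: prodr_ge0 => i _; exact: vp_weight_ge0.
have {1}-> : F x = \sum_j (w j)%:C * F x.
  by rewrite -mulr_suml -rmorph_sum /= sum_ffun_prod_vp_weight mul1r.
rewrite -sumrB; apply: le_trans (normc_sum _ _) _.
apply: (@le_trans _ _ (\sum_j (w j * e + K * (w j *
    \sum_i (1 - cos (2 * trigo.pi * (x ord0 i - (j i)%:R / M.+2%:R))))))).
  apply: ler_sum => j _; rewrite -mulrBr normcM normc_real (ger0_norm (w0 j)).
  rewrite mulrCA -mulrDr ler_wpM2l //; apply: le_trans (FK _ _) _.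
  by under eq_bigr do rewrite mxE.
rewrite big_split /= -mulr_suml sum_ffun_prod_vp_weight mul1r lerD2l -mulr_sumr.
rewrite le_eqVlt; apply/orP; left; apply/eqP; congr (_ * _).
under eq_bigr do rewrite mulr_sumr.
rewrite exchange_big /=.
under eq_bigr do rewrite sum_ffun_prod_vp_weight_dist.
by rewrite sumr_const card_ord mulr_natl.
Qed.

(** Shifting by a node changes only the constant term of [P i], and [exp_sum m] is closed under the
    products and powers that build the weights. *)
Lemma exp_sum_prod_vp_weight d m M (P : 'I_d -> {poly R})
    (j : {ffun 'I_d -> 'I_M.+2}) : (forall i, (size (P i) <= m.+1)%N) ->
  exp_sum m (fun n => (\prod_i vp_weight (j i) (P i).[n%:R])%:C).
Proof.
move=> sP; apply: (@eq_exp_sum _ _ (fun n =>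
    \prod_i (vp_weight (j i) (P i).[n%:R])%:C)) => [n|]; first by rewrite rmorph_prod.
apply: exp_sum_prod => i; pose b : R := (j i)%:R / M.+2%:R.
pose S : R := M.+2%:R * 'C(M.*2, M)%:R / 2 ^+ M.
apply: (@eq_exp_sum _ _ (fun n => (1 +
    (cos (2 * trigo.pi * (P i - b%:P).[n%:R]))%:C) ^+ M * (S^-1)%:C)) => [n|].
  rewrite hornerD hornerN hornerC -[1](rmorph1 (real_complex R)) -rmorphD.
  by rewrite -rmorphXn -rmorphM.
apply: exp_sumM; last exact: exp_sum_const.
apply: exp_sumX; apply: exp_sumD; first exact: exp_sum_const.
apply: exp_sum_cos; apply: leq_trans (size_polyD _ _) _.
by rewrite geq_max sP size_polyN (leq_trans (size_polyC_leq1 _)).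
Qed.

End ValleePoussin.

(** * Continuous functions on the torus and their modulus of continuity *)

Section TorusFunctions.
Variables (R : realType) (d : nat).
Implicit Types (x y : 'rV[R]_d).

Lemma torus_proj_int x y : (forall i, x ord0 i - y ord0 i \is a Num.int) ->
  torus_proj x = torus_proj y.
Proof. by move=> xy; apply/eqmodP/forallP. Qed.

(** A compact set containing a representative of every torus point, so that compactness arguments
    can be run in ['rV[R]_d]. *)
Let cube : set 'rV[R]_d := [set x | forall i, 0 <= x ord0 i <= 1].

Let cube_compact : compact cube.
Proof.
have := @rV_compact R d (fun=> `[0, 1]%classic) (fun=> @segment_compact R 0 1).
by congr compact; apply/seteqP; split=> x /= xI i; have := xI i; rewrite in_itv.
Qed.

Lemma compact_complex_bounded (F : 'rV[R]_d -> R[i]^o) (A : set 'rV[R]_d) :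
  compact A -> continuous F ->
  exists2 B : R, 0 <= B & forall x, A x -> normc (F x) <= B.
Proof.
move=> /compact_near_coveringP covA cF.
have [x Ax|B [_ BF]] := covA R +oo%R (fun B x => normc (F x) <= B) _.
  have /cvgrPdist_lt /(_ 1 ltr01) Fx := cF x.
  exists ([set y | `|F x - F y| < 1], [set B | normc (F x) + 1 <= B]).
    by split=> //=; by apply: nbhs_pinfty_ge; rewrite num_real.
  move=> [y B] /= [Fxy FxB]; apply: le_trans FxB.
  rewrite -(subrK (F x) (F y)) addrC; apply: le_trans (le_normcD _ _) _.
  by rewrite lerD2l -lecR -normcN opprB ltW.
(* The bound is known only for reals strictly above [B], hence the added 1; the maximum with 0
   ensures nonnegativity. *)
exists (Num.max B 0 + 1); first by rewrite addr_ge0 // le_max lexx orbT.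
by move=> x Ax; apply: BF => //; rewrite ltr_pwDr // le_max lexx.
Qed.

(** Only [x] is confined to [A]: in [torus_modulus] the representative chosen near a point of the
    cube may leave the cube. *)
Lemma compact_complex_unif_continuous (F : 'rV[R]_d -> R[i]^o)
    (A : set 'rV[R]_d) (e : R) : compact A -> continuous F -> 0 < e ->
  exists2 s : R, 0 < s & forall x y, A x ->
    (forall i, `|x ord0 i - y ord0 i| < s) -> normc (F x - F y) <= e.
Proof.
move=> /compact_near_coveringP covA cF e0.
have e2 : 0 < e / 2 by rewrite divr_gt0.
have := covA R (0 : R)^'+ (fun s x => forall y,
  (forall i, `|x ord0 i - y ord0 i| < s) -> normc (F x - F y) <= e) _.
case.
  move=> x Ax.
  have /cvgrPdist_lt /(_ (e / 2)%:C) := cF x; rewrite ltcR => /(_ e2) Fx.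
  have /nbhs_ballP[r /= r0 xr] := Fx.
  have r2 : 0 < r / 2 by rewrite divr_gt0.
  exists (ball x (r / 2), [set s | s < r / 2]).
    by split=> /=; [exact: nbhsx_ballx|exact: nbhs_right_lt].
  move=> [x' s] /= [xx' sr] y x'y.
  have Fxx' : normc (F x - F x') <= e / 2.
    rewrite -lecR ltW //; apply: xr; apply: le_ball xx'.
    by rewrite ler_pdivrMr // ler_pMr // ler1n.
  have Fxy : normc (F x - F y) <= e / 2.
    rewrite -lecR ltW //; apply: xr; split=> // i j.
    have [_ xx'j] := xx'; rewrite (splitr r); apply: ball_triangle (xx'j i j) _.
    by rewrite (ord1 i); apply: lt_trans (x'y j) sr.
  rewrite (splitr e) -(subrKA (F x)) addrC.
  apply: le_trans (le_normcD _ _) _.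
  by rewrite lerD // -normcN opprB.
move=> r /= r0 rF; exists (r / 2); first by rewrite divr_gt0.
move=> x y Ax; apply: rF => //; last by rewrite divr_gt0.
rewrite /ball /= sub0r normrN gtr0_norm ?divr_gt0 //.
by rewrite ltr_pdivrMr // ltr_pMr // ltr1n.
Qed.

(** Cosine is even and decreasing on [[0, pi]], and [|t| <= 1/2] keeps the angle in that
    interval. *)
Lemma one_sub_cos_ge (s t : R) : 0 < s -> s <= `|t| <= 2^-1 ->
  1 - cos (2 * trigo.pi * s) <= 1 - cos (2 * trigo.pi * t).
Proof.
move=> s0 /andP[st t2].
have -> : cos (2 * trigo.pi * t) = cos (2 * trigo.pi * `|t|).
  by case: (ger0P t) => // _; rewrite mulrN cosN.
have pi2 : 0 < 2 * trigo.pi :> R by rewrite mulr_gt0 ?pi_gt0.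
have itv u : 0 <= u <= 2^-1 -> 2 * trigo.pi * u \in `[0, (trigo.pi : R)].
  move=> /andP[u0 u2]; rewrite in_itv /= mulr_ge0 ?(ltW pi2) //=.
  apply: le_trans (ler_wpM2l (ltW pi2) u2) _.
  by rewrite mulrC mulrA mulVf ?mul1r.
rewrite lerD2l lerN2 leNgt ltr_cos ?itv ?normr_ge0 //.
  by rewrite -leNgt ler_wpM2l // ltW.
by rewrite (ltW s0) (le_trans st).
Qed.

Lemma one_sub_cos_gt0 (s : R) : 0 < s <= 2^-1 ->
  0 < 1 - cos (2 * trigo.pi * s).
Proof.
move=> /andP[s0 s2]; rewrite subr_gt0 lt_neqAle cos_le1 andbT.
apply/eqP => cos1; have s1 : `|s| < 1.
  by rewrite gtr0_norm // (le_lt_trans s2) // invf_lt1 ?ltr1n.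
suff /(expi_eq1 s1) : expi s = 1 by apply/eqP/lt0r_neq0.
rewrite /expi cos1; congr (_ +i* _); apply/eqP.
by rewrite -sqrf_eq0 sin2cos2 cos1 expr1n subrr.
Qed.

Lemma one_sub_cos_ge0 (s : R) : 0 <= 1 - cos s.
Proof. by rewrite subr_ge0 cos_le1. Qed.

Lemma cosDint (t z : R) : z \is a Num.int ->
  cos (2 * trigo.pi * (t + z)) = cos (2 * trigo.pi * t).
Proof.
move=> /expi_int ez; have := expiD t z.
by rewrite ez mulr1 => -[].
Qed.

(** Take representatives whose coordinates differ by at most 1/2. If all differences are below [s],
    uniform continuity gives [e]; otherwise one cosine term is at least [v], and [K * v = 2 * B]
    already bounds the oscillation. *)
Lemma torus_modulus (phi : torus R d -> R[i]^o) (e : R) :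
  continuous phi -> 0 < e -> exists2 K : R, 0 <= K &
    forall x y, normc (phi (torus_proj x) - phi (torus_proj y)) <=
      e + K * \sum_i (1 - cos (2 * trigo.pi * (x ord0 i - y ord0 i))).
Proof.
move=> cphi e0; pose F x := phi (torus_proj x).
have cF : continuous F.
  by move=> x; apply: continuous_comp; [exact: pi_continuous|exact: cphi].
have [B B0 FB] := compact_complex_bounded cube_compact cF.
have [s' s'0 Fs'] := compact_complex_unif_continuous cube_compact cF e0.
(* The cap 1/2 makes [one_sub_cos_gt0] applicable to [s]. *)
pose s := Num.min s' 2^-1.
have s0 : 0 < s by rewrite lt_min s'0 invr_gt0 ltr0n.
have s2 : s <= 2^-1 by rewrite ge_min lexx orbT.
pose v := 1 - cos (2 * trigo.pi * s).
have v0 : 0 < v by apply: one_sub_cos_gt0; rewrite s0.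
exists (2 * B / v); first by rewrite divr_ge0 ?mulr_ge0 ?(ltW v0).
move=> x y.
pose frac (z : 'rV[R]_d) : 'rV[R]_d :=
  \row_i (z ord0 i - (Num.floor (z ord0 i))%:~R).
have frac_cube z : cube (frac z).
  move=> i; have := floorD1_gt (z ord0 i); rewrite intrD mxE => zi.
  by rewrite subr_ge0 ge_floor /=; lra.
have projfrac z : torus_proj z = torus_proj (frac z).
  by apply: torus_proj_int => i; rewrite mxE opprB addrC subrK rpred_int.
have Fbound z : normc (F z) <= B by rewrite /F projfrac; exact: FB.
(* A nearest integer to [y_i - frac x_i]; subtracting it from [y_i] lands within 1/2 of
   [frac x_i]. *)
pose k (i : 'I_d) := Num.floor (y ord0 i - frac x ord0 i + 2^-1).
pose y' : 'rV[R]_d := \row_i (y ord0 i - (k i)%:~R).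
have FyE : F y = F y'.
  rewrite /F; congr phi; apply: torus_proj_int => i.
  by rewrite mxE opprB addrC subrK rpred_int.
have y'2 i : `|frac x ord0 i - y' ord0 i| <= 2^-1.
  rewrite distrC mxE ler_norml.
  have := ge_floor (y ord0 i - frac x ord0 i + 2^-1).
  have := floorD1_gt (y ord0 i - frac x ord0 i + 2^-1).
  by rewrite -/(k i) intrD; lra.
have cosE i : cos (2 * trigo.pi * (x ord0 i - y ord0 i)) =
    cos (2 * trigo.pi * (frac x ord0 i - y' ord0 i)).
  rewrite -(cosDint (frac x ord0 i - y' ord0 i)
    (z := (Num.floor (x ord0 i))%:~R - (k i)%:~R)); last first.
    by rewrite rpredB ?rpred_int.
  by congr (cos (_ * _)); rewrite !mxE; ring.
rewrite -[phi _]/(F x) -[phi (torus_proj y)]/(F y) FyE.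
have -> : F x = F (frac x) by rewrite /F projfrac.
under eq_bigr do rewrite cosE.
have sum_ge0 : 0 <= \sum_i (1 - cos (2 * trigo.pi * (frac x ord0 i - y' ord0 i))).
  by apply: sumr_ge0 => i _; exact: one_sub_cos_ge0.
have K0 : 0 <= 2 * B / v by rewrite divr_ge0 ?mulr_ge0 ?(ltW v0).
have [[i far]|near_xy] :=
    pselect (exists i, s <= `|frac x ord0 i - y' ord0 i|); last first.
  rewrite ler_wpDr ?(mulr_ge0 K0 sum_ge0) //; apply: Fs' => // i.
  apply: (@lt_le_trans _ _ s); last by rewrite ge_min lexx.
  by rewrite ltNge; apply/negP => far; apply: near_xy; exists i.
rewrite ler_wpDl ?(ltW e0) //; apply: le_trans (le_normcD _ _) _.
rewrite normcN; apply: (@le_trans _ _ (2 * B)).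
  by rewrite mulr_natl mulr2n lerD // -FyE Fbound.
rewrite -[leLHS](divfK (lt0r_neq0 v0)) ler_wpM2l //.
have far2 : s <= `|frac x ord0 i - y' ord0 i| <= 2^-1 by rewrite far y'2.
apply: le_trans (one_sub_cos_ge s0 far2) _.
by rewrite (bigD1 i) //= lerDl sumr_ge0 // => j _; exact: one_sub_cos_ge0.
Qed.

End TorusFunctions.

Theorem theorem1 (R : realType) (d k : nat) (hd : (2 <= d)%N) (hk : (1 <= k)%N)
    (c : nat -> complex R) (hc : admissible_seq c)
    (hosc : oscillating (d + k - 1)%N c)
    (f : 'rV[R]_d -> 'rV[R]_d) (hf : simple_skew_product hd k f) :
  linearly_disjoint c f.
Proof.
move=> phi cphi x; apply: mean_to_zero_approx => // e e0.
have e2 : 0 < e / 2 by rewrite divr_gt0.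
have [K K0 phiK] := torus_modulus cphi e2.
have [P PE] := skew_product_orbit_poly x hk hf.
(* Truncation gives [K * d / (e / 2) < M + 1], so the averaged cosine terms contribute at most
   [e / 2]. *)
pose M := Num.truncn (K * d%:R / (e / 2)).
have KM : K * (d%:R / M.+1%:R) <= e / 2.
  rewrite mulrA ler_pdivrMr // [leRHS]mulrC -ler_pdivrMr // ltW //.
  by rewrite truncnS_gt.
(* The approximant of [vp_approx] along the orbit, with coordinates written as polynomials in [n];
   the values of [phi] at the nodes are constant coefficients. *)
exists (fun n => \sum_(j : {ffun 'I_d -> 'I_M.+2})
    (\prod_i vp_weight (j i) (P i).[n%:R])%:C *
    phi (torus_proj (\row_i ((j i)%:R / M.+2%:R)))).
  apply: oscillating_exp_sum hosc _; apply: exp_sum_sum => j.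
  apply: exp_sumM; last exact: exp_sum_const.
  by apply: exp_sum_prod_vp_weight => i; have [] := PE i.
move=> n; have := vp_approx M phiK (iter n f x).
under eq_bigr do under eq_bigr do rewrite (PE _).2.
by move=> H; apply: le_trans H _; rewrite [leRHS]splitr lerD2l.
Qed.
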